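(* Let $\mathbb{K}$ be a field and let $\mathcal{F}=\{f_1,\dots,f_k\}\subseteq\mathbb{K}[x_1,\dots,x_n]$ be a finite family of polynomials of degree at least $1$ such that $\mathrm{d}_{\mathrm{reg}}(\mathcal{F})<\infty$ (and so $k\geq n$). Let $d_i=\deg(f_i)$ and suppose that $d_1\geq d_2\geq\dots\geq d_k$. Then, for every degree-compatible term order $\sigma$, $$\mathrm{sd}_{\sigma}(\mathcal{F})\leq d_1+\dots+d_n-n+2.$$
   Context: $\mathbb{K}$ is an arbitrary field (not necessarily finite), and $(\mathcal{F})$ denotes the ideal of $\mathbb{K}[x_1,\dots,x_n]$ generated by $\mathcal{F}$. For a nonzero polynomial $p$, $p^{\mathrm{top}}$ is the homogeneous part of largest degree of $p$. For an ideal $\mathcal{I}$, $\mathcal{I}_d$ is the set of homogeneous polynomials of degree $d$ in $\mathcal{I}$ (including $0$). Degree of regularity: $\mathrm{d}_{\mathrm{reg}}(\mathcal{F})$ is the smallest integer $d\ge 0$ for which $(\mathcal{F}^{\mathrm{top}})_d=(\mathbb{K}[x_1,\dots,x_n])_d$, where $\mathcal{F}^{\mathrm{top}}=\{f_1^{\mathrm{top}},\dots,f_k^{\mathrm{top}}\}$ and $(\mathcal{F}^{\mathrm{top}})$ is the ideal it generates; if no such $d$ exists, $\mathrm{d}_{\mathrm{reg}}(\mathcal{F})=+\infty$. For an integer $d$, $V_{\mathcal{F},d}$ is the smallest $\mathbb{K}$-linear subspace of $\mathbb{K}[x_1,\dots,x_n]$ (with respect to inclusion) such that (i) $\{f\in\mathcal{F}:\deg(f)\leq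 d\}\subseteq V_{\mathcal{F},d}$, and (ii) for every monomial $m$ and every $f\in V_{\mathcal{F},d}$ with $\deg(mf)\leq d$, one has $mf\in V_{\mathcal{F},d}$. A term order is degree-compatible if $\deg(m)<\deg(m')$ implies that $m$ is smaller than $m'$. Solving degree: for a degree-compatible term order $\sigma$, $\mathrm{sd}_{\sigma}(\mathcal{F})$ is the smallest $d$ for which $V_{\mathcal{F},d}$ contains a Gröbner basis of the ideal $(\mathcal{F})$ with respect to $\sigma$. *)

(* Defs.v *)
From mathcomp Require Import all_boot all_algebra.
From mathcomp Require Import mpoly.

Set Implicit Arguments.
Unset Strict Implicit.
Unset Printing Implicit Defensive.

Import GRing.Theory.
Local Open Scope ring_scope.

Definition is_least (P : nat -> Prop) (d : nat) : Prop :=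
  P d /\ forall e : nat, P e -> (d <= e)%N.

Section Defs.
Variables (n : nat) (K : fieldType).
Implicit Types (p q f : {mpoly K[n]}) (m : 'X_{1..n}) (d : nat).
Implicit Types (S V I : {mpoly K[n]} -> Prop) (F G : seq {mpoly K[n]}).

(* The zero polynomial gets the value 0; in the bounds [pdeg _ <= d] below,
   with d a natural number, this agrees with the convention deg 0 = -oo. *)
Definition pdeg p : nat := (msize p).-1.

Definition ptop p : {mpoly K[n]} := pihomog mdeg (pdeg p) p.

Definition is_ideal I : Prop :=
  [/\ I 0,
      forall p q, I p -> I q -> I (p + q)
    & forall q p, I p -> I (q * p)].

Definition ideal_gen S p : Prop :=
  forall I, is_ideal I -> (forall f, S f -> I f) -> I p.

Definition ideal F : {mpoly K[n]} -> Prop := ideal_gen (fun f => f \in F).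

Definition hom_part I d p : Prop := I p /\ p \is d.-homog.

(* The degree of regularity is finite iff some d satisfies this. *)
Definition is_degree_of_regularity F : nat -> Prop :=
  is_least (fun d => forall p,
    hom_part (ideal (map ptop F)) d p <-> hom_part (fun=> True) d p).

Definition is_subspace V : Prop :=
  [/\ V 0,
      forall p q, V p -> V q -> V (p + q)
    & forall (c : K) p, V p -> V (c *: p)].

Definition V_admissible F d V : Prop :=
  [/\ is_subspace V,
      forall f, f \in F -> (pdeg f <= d)%N -> V f
    & forall m f, V f -> (pdeg ('X_[m] * f) <= d)%N -> V ('X_[m] * f)].

(* Admissible subspaces are stable under intersection, so this is the smallest
   one. *)
Definition Vspace F d p : Prop := forall V, V_admissible F d V -> V p.

(* [sigma m m'] reads "m is smaller than or equal to m'". *)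
Definition is_term_order (sigma : rel 'X_{1..n}) : Prop :=
  [/\ total sigma, antisymmetric sigma, transitive sigma,
      forall m, sigma 0%MM m
    & forall m m1 m2, sigma m1 m2 -> sigma (m1 + m)%MM (m2 + m)%MM].

Definition degree_compatible (sigma : rel 'X_{1..n}) : Prop :=
  forall m m', (mdeg m < mdeg m')%N -> sigma m m' && (m != m').

(* Never holds for f = 0, which has empty support. *)
Definition is_lead_mono (sigma : rel 'X_{1..n}) f m : Prop :=
  m \in msupp f /\ forall m', m' \in msupp f -> sigma m' m.

Definition lead_monos (sigma : rel 'X_{1..n}) S p : Prop :=
  exists f m, [/\ S f, is_lead_mono sigma f m & p = 'X_[m]].

Definition is_groebner_basis (sigma : rel 'X_{1..n}) G I : Prop :=
  (forall g, g \in G -> I g) /\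
  (forall p, ideal_gen (lead_monos sigma (fun g => g \in G)) p <->
             ideal_gen (lead_monos sigma I) p).

Definition is_solving_degree (sigma : rel 'X_{1..n}) F : nat -> Prop :=
  is_least (fun d => exists G, (forall g, g \in G -> Vspace F d g) /\
                               is_groebner_basis sigma G (ideal F)).

End Defs.

(* Main.v *)
Require Import Defs.
From mathcomp Require Import all_boot all_algebra.
From mathcomp Require Import mpoly.
From mathcomp Require Import zify.
From Stdlib Require Import Classical IndefiniteDescription.

(** The theorem combines two facts about D := d_1 + ... + d_n - n + 1.

    Macaulay bound ([macaulay_bound]): the top parts g_1, ..., g_k generate
    every form of degree D, and n <= k.  The usual proof replaces the g_i by
    n generic combinations forming a regular sequence, which needs an infinite
    field and prime avoidance.  The argument below avoids any genericity.
    Finiteness of the degree of regularity gives an N with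
    x_j^N = sum_i A_ji g_i for all j.  In the exterior algebra over e_1, ...,
    e_k put W_n := alpha_n /\ ... /\ alpha_1 with alpha_j := sum_i A_ji e_i.
    Its coordinates are the maximal minors of A, and
    - if p W_n has all its coordinates in (x_1^N, ..., x_n^N), then p lies in
      (g_1, ..., g_k) ([colon_rows_wedge]): applying the Koszul differential of
      g to p W_r and dividing by the regular element x_r^N lowers r by one,
      and at r = 0 one reads that p is a combination of the g_i;
    - the coordinate of p W_n at a set T of n indices has order at least
      deg p + nN - sum_(i in T) d_i, and a monomial of degree more than
      n(N - 1) is divisible by some x_j^N.
    So every p with deg p > sum_(i <= n) d_i - n is in (g_1, ..., g_k).  When
    k < n there is no such T, hence W_n = 0 and 1 would be in that ideal.

    Solving degree ([ideal_sub_Vspace], [Vspace_groebner]): write V for the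
    space in degree D + 1.  By the Macaulay bound each monomial of degree D is
    congruent modulo V to a polynomial of degree less than D.  Hence
    multiplication by x_i, followed by such a reduction, acts on polynomials of
    degree less than D modulo V.  These actions commute, because x_i x_j p has
    degree at most D + 1 and so both orders of reduction agree modulo V: this
    is what the extra degree in D + 1 is for.  They thus define a linear normal
    form on the whole polynomial ring ([normal_form]); the polynomials with
    normal form in V are an ideal containing the family, and normal forms are
    trivial up to degree D, so V contains every element of degree at most D of
    the ideal generated by the family.  As V also contains, for each monomial
    of degree D, a polynomial with that leading monomial, the elements of V of
    degree at most D have all the leading monomials that are needed, and
    finitely many of them form a Groebner basis. *)

Set Implicit Arguments.
Unset Strict Implicit.
Unset Printing Implicit Defensive.

Import GRing.Theory.
Local Open Scope ring_scope.

(** * Koszul differential and a colon property of regular sequences *)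

Section Koszul.
Variable R : comNzRingType.
Implicit Types (a c g : nat -> R) (p x y : R) (k r : nat).

Definition in_span a r x : Prop :=
  exists c, x = \sum_(i < r) c i * a i.

Lemma in_span0 a r : in_span a r 0.
Proof. by exists (fun=> 0); rewrite big1 // => i _; rewrite mul0r. Qed.

Lemma in_spanD a r x y : in_span a r x -> in_span a r y -> in_span a r (x + y).
Proof.
move=> [c ->] [d ->]; exists (fun i => c i + d i).
by rewrite -big_split; apply: eq_bigr => i _; rewrite mulrDl.
Qed.

Lemma in_spanM a r p x : in_span a r x -> in_span a r (p * x).
Proof.
move=> [c ->]; exists (fun i => p * c i).
by rewrite mulr_sumr; apply: eq_bigr => i _; rewrite mulrA.
Qed.

Lemma in_span_mem a r i : (i < r)%N -> in_span a r (a i).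
Proof.
move=> ltir; exists (fun j => (i == j)%:R).
rewrite (bigD1 (Ordinal ltir)) //= eqxx mul1r big1 ?addr0 // => j.
by rewrite -val_eqE /= eq_sym => /negPf ->; rewrite mul0r.
Qed.

Lemma in_span_widen a r x : in_span a r x -> in_span a r.+1 x.
Proof.
move=> [c ->]; exists (fun i => if (i < r)%N then c i else 0).
rewrite big_ord_recr /= ltnn mul0r addr0.
by apply: eq_bigr => i _; rewrite ltn_ord.
Qed.

(** The exterior algebra of a free module of rank k, split along its last basis
    vector: a pair (u, v) of [ext k.+1] stands for u + e_k /\ v.  This keeps the
    sign rules of the Koszul differential and of wedging inside two one-line
    recursions. *)
Fixpoint ext k : lmodType R :=
  if k is k'.+1 then (ext k' * ext k')%type else R^o.

(** From d (e_k /\ v) = g_k v - e_k /\ d v. *)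
Fixpoint koszul g k : ext k -> ext k :=
  if k is k'.+1 return ext k -> ext k then
    fun w => (koszul g w.1 + g k' *: w.2, - koszul g w.2)
  else fun=> 0.

(** Left exterior multiplication by the vector sum_i c_i e_i; the sign comes
    from moving e_k in front of that vector. *)
Fixpoint wedge c k : ext k -> ext k :=
  if k is k'.+1 return ext k -> ext k then
    fun w => (wedge c w.1, c k' *: w.1 - wedge c w.2)
  else fun=> 0.

Fixpoint ext_scalar k p : ext k :=
  if k is k'.+1 return ext k then (ext_scalar k' p, 0) else p.

Fixpoint scalar_part k : ext k -> R :=
  if k is k'.+1 return ext k -> R then fun w => scalar_part w.1 else id.

Fixpoint coords (P : R -> Prop) k : ext k -> Prop :=
  if k is k'.+1 return ext k -> Prop then
    fun w => coords P w.1 /\ coords P w.2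
  else P.

Lemma coords_impl (P Q : R -> Prop) k (w : ext k) :
  (forall x, P x -> Q x) -> coords P w -> coords Q w.
Proof.
move=> PQ; elim: k w => [|k IHk] w /=; first exact: PQ.
by move=> [w1 w2]; split; apply: IHk.
Qed.

Lemma koszulD g k (w z : ext k) : koszul g (w + z) = koszul g w + koszul g z.
Proof.
elim: k w z => [|k IHk] w z /=; first by rewrite addr0.
congr (_, _); rewrite IHk.
  by rewrite scalerDr addrACA.
by rewrite opprD.
Qed.

Lemma koszulZ g k p (w : ext k) : koszul g (p *: w) = p *: koszul g w.
Proof.
elim: k w => [|k IHk] w /=; first by rewrite scaler0.
congr (_, _); rewrite IHk.
  by rewrite scalerDr !scalerA mulrC.
by rewrite scalerN.
Qed.

Lemma koszul0 g k : koszul g (0 : ext k) = 0.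
Proof. by rewrite -[X in koszul g X](scale0r (0 : ext k)) koszulZ scale0r. Qed.

Lemma koszulN g k (w : ext k) : koszul g (- w) = - koszul g w.
Proof. by rewrite -scaleN1r koszulZ scaleN1r. Qed.

Lemma koszul_koszul g k (w : ext k) : koszul g (koszul g w) = 0.
Proof.
elim: k w => [//|k IHk] w /=; congr (_, _).
  by rewrite koszulD koszulZ IHk add0r scalerN subrr.
by rewrite koszulN IHk !oppr0.
Qed.

Lemma wedgeD c k (w z : ext k) : wedge c (w + z) = wedge c w + wedge c z.
Proof.
elim: k w z => [|k IHk] w z /=; first by rewrite addr0.
by congr (_, _); rewrite IHk // scalerDr opprD addrACA.
Qed.

Lemma wedgeZ c k p (w : ext k) : wedge c (p *: w) = p *: wedge c w.
Proof.
elim: k w => [|k IHk] w /=; first by rewrite scaler0.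
by congr (_, _); rewrite IHk // scalerBr !scalerA mulrC.
Qed.

Lemma wedgeN c k (w : ext k) : wedge c (- w) = - wedge c w.
Proof. by rewrite -scaleN1r wedgeZ scaleN1r. Qed.

(** The graded Leibniz rule, where the differential of the vector
    sum_i c_i e_i is the scalar sum_i c_i g_i. *)
Lemma koszul_wedge g c k (w : ext k) :
  koszul g (wedge c w)
    = (\sum_(i < k) c i * g i) *: w - wedge c (koszul g w).
Proof.
elim: k w => [|k IHk] w /=; first by rewrite big_ord0 scale0r subr0.
rewrite big_ord_recr; apply: injective_projections => /=.
  rewrite IHk wedgeD wedgeZ scalerDl scalerBr scalerA (mulrC (g k)) opprD.
  by rewrite addrACA.
rewrite koszulD koszulZ koszulN IHk wedgeN scalerDl scalerDr scalerA.
rewrite opprK opprB (addrAC (c k *: _)) (opprD (_ + _)) addrACA subrr addr0.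
by rewrite opprD addrA addrAC.
Qed.

Section Coordinates.
Variables (a : nat -> R) (r : nat).
Local Notation coordsI := (coords (in_span a r)).

Lemma coords0 k : coordsI (0 : ext k).
Proof. by elim: k => [|k IHk] /=; [apply: in_span0 | split]. Qed.

Lemma coordsD k (w z : ext k) : coordsI w -> coordsI z -> coordsI (w + z).
Proof.
elim: k w z => [|k IHk] w z /=; first exact: in_spanD.
by move=> [w1 w2] [z1 z2]; split; apply: IHk.
Qed.

Lemma coordsZ k p (w : ext k) : coordsI w -> coordsI (p *: w).
Proof.
elim: k w => [|k IHk] w /=; first exact: in_spanM.
by move=> [w1 w2]; split; apply: IHk.
Qed.

Lemma coordsN k (w : ext k) : coordsI w -> coordsI (- w).
Proof. by rewrite -scaleN1r; apply: coordsZ. Qed.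

Lemma coordsZ_mem k p (w : ext k) : in_span a r p -> coordsI (p *: w).
Proof.
move=> Ip; elim: k w => [|k IHk] w /=; last by split; apply: IHk.
by rewrite -[p *: w]/(p * w) mulrC; apply: in_spanM.
Qed.

Lemma coords_koszul g k (w : ext k) : coordsI w -> coordsI (koszul g w).
Proof.
elim: k w => [|k IHk] w /=; first by move=> _; apply: in_span0.
move=> [w1 w2]; split; last by apply/coordsN/IHk.
by apply: coordsD; [apply: IHk | apply: coordsZ].
Qed.

Lemma coords_wedge c k (w : ext k) : coordsI w -> coordsI (wedge c w).
Proof.
elim: k w => [|k IHk] w /=; first by move=> _; apply: in_span0.
move=> [w1 w2]; split; first exact: IHk.
by apply: coordsD; [apply: coordsZ | apply/coordsN/IHk].
Qed.

Lemma coords_regular k (w : ext k) :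
    (forall x, in_span a r (a r * x) -> in_span a r x) ->
  coordsI (a r *: w) -> coordsI w.
Proof.
move=> reg; elim: k w => [|k IHk] w /=; first exact: reg.
by move=> [w1 w2]; split; apply: IHk.
Qed.

End Coordinates.

Lemma coords_widen a r k (w : ext k) :
  coords (in_span a r) w -> coords (in_span a r.+1) w.
Proof. by apply: coords_impl => x; apply: in_span_widen. Qed.

(** Division by the last generator, performed coordinatewise. *)
Lemma coords_split a r k (w : ext k) : coords (in_span a r.+1) w ->
  exists z, coords (in_span a r) (w - a r *: z).
Proof.
elim: k w => [|k IHk] w /=.
  move=> [c ->]; exists (c r); rewrite big_ord_recr /= (mulrC (c r)) addrK.
  by exists c.
move=> [/IHk [z1 ?] /IHk [z2 ?]].
by exists (z1, z2).
Qed.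

(** The wedge of rows 0, ..., r - 1 of A; its coordinates are the r-minors of
    these rows, up to sign. *)
Fixpoint rows_wedge (A : nat -> nat -> R) k r : ext k :=
  if r is r'.+1 then wedge (A r') (rows_wedge A k r') else ext_scalar k 1.

Lemma scalar_part_koszul g k (w : ext k) : in_span g k (scalar_part (koszul g w)).
Proof.
elim: k w => [|k IHk] w /=; first exact: in_span0.
have -> (u v : ext k) : scalar_part (u + v) = scalar_part u + scalar_part v.
  by elim: k u v {IHk w} => [//|k IHk] u v /=.
apply: in_spanD; first exact: in_span_widen.
have -> p (u : ext k) : scalar_part (p *: u) = p * scalar_part u.
  by elim: k u {IHk w} => [//|k IHk] u /=.
by rewrite mulrC; apply/in_spanM/in_span_mem.
Qed.

(** If a = A g with a regular, then the colon of (a) by the maximal minors of A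
    is contained in (g).  Write W_r for the wedge of the first r rows.  The
    statement that descends on r is: p W_r is a Koszul boundary modulo
    (a_0, ..., a_(r-1)).  Differentiating p W_(r+1) = a_r y + d z modulo
    (a_0, ..., a_(r-1)) gives a_r (p W_r - d y) = 0 by the Leibniz rule, since
    d W_r vanishes modulo these elements, and a_r can be cancelled. *)
Theorem colon_rows_wedge (a g : nat -> R) (A : nat -> nat -> R) n k p :
    (forall r x, (r < n)%N -> in_span a r (a r * x) -> in_span a r x) ->
    (forall r, (r < n)%N -> a r = \sum_(i < k) A r i * g i) ->
    coords (in_span a n) (p *: rows_wedge A k n) ->
  in_span g k p.
Proof.
move=> reg defa.
(* The Leibniz rule writes d W_r as a combination of a_0, ..., a_(r-1). *)
have koszulW r : (r <= n)%N ->
    coords (in_span a r) (koszul g (rows_wedge A k r)).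
  elim: r => [|r IHr] lern /=.
    suff ->: koszul g (ext_scalar k 1) = 0 by apply: coords0.
    elim: k {defa} => [//|k IHk] /=.
    by rewrite IHk !(scaler0, koszul0, oppr0, addr0).
  rewrite koszul_wedge -defa //; apply: coordsD.
    by apply/coordsZ_mem/in_span_mem.
  by apply/coordsN/coords_wedge/coords_widen/IHr/ltnW.
suff descent r : (r <= n)%N ->
    (exists z, coords (in_span a r) (p *: rows_wedge A k r - koszul g z)) ->
    in_span g k p.
  move=> Wn; apply: (descent n) => //; exists 0.
  by rewrite koszul0 subr0.
elim: r => [|r IHr] lern [z Iz].
  have coords_eq0 m (w : ext m) : coords (in_span a 0) w -> w = 0.
    elim: m w => [|m IHm] w /=; first by move=> [c ->]; rewrite big_ord0.
    by case: w => u v /= [/IHm -> /IHm ->].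
  have /eqP := coords_eq0 _ _ Iz; rewrite subr_eq0 => /eqP defp.
  have -> : p = scalar_part (p *: rows_wedge A k 0).
    elim: k {defa koszulW z Iz coords_eq0 defp} => [|k IHk] /=.
      by rewrite /GRing.scale /= mulr1.
    exact: IHk.
  by rewrite defp; apply: scalar_part_koszul.
apply: IHr; first exact: ltnW.
have [y Iy] := coords_split Iz.
exists y.
apply: (@coords_regular a r) => [x|]; first exact: reg.
have := coordsD (coords_koszul g Iy)
                (coordsZ p (coords_wedge (A r) (koszulW r (ltnW lern)))).
rewrite /= !(koszulD, koszulN, koszulZ) koszul_koszul subr0 koszul_wedge.
by rewrite -defa // scalerBr addrAC subrK scalerBr !scalerA mulrC.
Qed.

End Koszul.

(** * The Macaulay bound *)

Section Macaulay.
Variables (n : nat) (K : fieldType).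
Local Notation R := {mpoly K[n]}.
Implicit Types (p q : R) (m : 'X_{1..n}) (g : nat -> R) (d : nat -> nat).
Implicit Types (k r s : nat).

Definition order_ge s p := forall m, m \in msupp p -> (s <= mdeg m)%N.

Lemma order_ge0 s : order_ge s 0.
Proof. by move=> m; rewrite msupp0. Qed.

Lemma order_geB s p q : order_ge s p -> order_ge s q -> order_ge s (p - q).
Proof.
move=> hp hq m /msuppB_le; rewrite mem_cat => /orP[]; [exact: hp | exact: hq].
Qed.

Lemma order_geM s t p q :
  order_ge s p -> order_ge t q -> order_ge (s + t) (p * q).
Proof.
move=> hp hq m /msuppM_le /allpairsP [[m1 m2] /= [/hp h1 /hq h2 ->]].
by rewrite mdegD leq_add.
Qed.

Lemma order_geW s t p : (s <= t)%N -> order_ge t p -> order_ge s p.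
Proof. by move=> lest hp m /hp; apply: leq_trans. Qed.

Lemma order_ge_homog s t p : (s <= t)%N -> p \is t.-homog -> order_ge s p.
Proof. by move=> lest /dhomogP hp m /hp ->. Qed.

(** An element of exterior degree r whose coordinate at an index set T has order
    at least s - sum_(i in T) d_i: the order is bounded below by s when e_i is
    given the degree d_i.  Truncated subtraction is harmless in a lower bound. *)
Fixpoint ext_order_ge d k s r : ext R k -> Prop :=
  if k is k'.+1 return ext R k -> Prop then fun w =>
    ext_order_ge d s r w.1 /\
    (if r is r'.+1 then ext_order_ge d (s - d k') r' w.2 else w.2 = 0)
  else fun w => order_ge s w /\ (r <> 0%N -> w = 0).

Lemma ext_order_ge_eq0 d k s r : ext_order_ge d s r (0 : ext R k).
Proof.
elim: k s r => [|k IHk] s r /=; first by split=> //; apply: order_ge0.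
by split; [apply: IHk | case: r].
Qed.

Lemma ext_order_geB d k s r (w z : ext R k) :
  ext_order_ge d s r w -> ext_order_ge d s r z -> ext_order_ge d s r (w - z).
Proof.
elim: k s r w z => [|k IHk] s r w z /=.
  move=> [w1 w2] [z1 z2]; split; first exact: order_geB.
  by move=> r0; rewrite w2 ?z2 ?subr0.
move=> [w1 w2] [z1 z2]; split; first exact: IHk.
case: r w2 z2 {w1 z1} => [-> ->|r]; [exact: subr0 | exact: IHk].
Qed.

Lemma ext_order_geW d k s t r (w : ext R k) : (s <= t)%N ->
  ext_order_ge d t r w -> ext_order_ge d s r w.
Proof.
elim: k s t r w => [|k IHk] s t r w lest /=.
  by move=> [w1 w2]; split; first exact: order_geW w1.
move=> [w1 w2]; split; first exact: IHk w1.
by case: r w2 {w1} => // r; apply: IHk; apply: leq_sub2r.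
Qed.

Lemma ext_order_geZ d k s t r p (w : ext R k) : order_ge t p ->
  ext_order_ge d s r w -> ext_order_ge d (s + t) r (p *: w).
Proof.
move=> hp; elim: k s r w => [|k IHk] s r w /=.
  move=> [w1 w2]; split; first by rewrite addnC; apply: order_geM.
  by move=> /w2 ->; rewrite scaler0.
move=> [w1 w2]; split; first exact: IHk.
case: r w2 {w1} => [->|r /IHk]; first by rewrite scaler0.
by apply: ext_order_geW; lia.
Qed.

Lemma ext_order_ge_wedge d k s N r (c : nat -> R) (w : ext R k) :
    (forall i, (i < k)%N -> order_ge (N - d i) (c i)) ->
  ext_order_ge d s r w -> ext_order_ge d (s + N) r.+1 (wedge c w).
Proof.
elim: k s r w => [|k IHk] s r w hc /=; first by split=> //; apply: order_ge0.
have {}IHk := IHk _ _ _ (fun i ltik => hc i (ltnW ltik)).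
move=> [w1 w2]; split; first exact: IHk.
apply: ext_order_geB.
  by apply: ext_order_geW (ext_order_geZ (hc k _) w1) => //; lia.
case: r w2 {w1} => [->|r /IHk].
  by have -> : wedge c (0 : ext R k) = 0
    by [rewrite -[X in wedge c X](scale0r (0 : ext R k)) wedgeZ scale0r];
    apply: ext_order_ge_eq0.
by apply: ext_order_geW; lia.
Qed.

(** The weights being nonincreasing, the sum of the d_i over r distinct indices
    is at most that of the first r ones; with fewer than r indices there is no
    coordinate at all, hence the conclusion r <= k. *)
Lemma ext_order_ge_coords d k s r (w : ext R k) :
    (forall i j, (i <= j < k)%N -> (d j <= d i)%N) ->
    ext_order_ge d s r w ->
  coords (fun x => forall m, m \in msupp x ->
    (r <= k)%N /\ (s <= mdeg m + \sum_(i < r) d i)%N) w.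
Proof.
elim: k s r w => [|k IHk] s r w dmono /=.
  move=> [w1 w2] m mw; case: r w2 => [_|r w2].
    by split=> //; rewrite big_ord0 addn0; apply: w1.
  by move: mw; rewrite w2 // msupp0.
have dmono' i j : (i <= j < k)%N -> (d j <= d i)%N.
  by move=> /andP[leij ltjk]; apply: dmono; rewrite leij ltnW.
move=> [w1 w2]; split.
  apply: coords_impl (IHk s r _ dmono' w1) => x hx m /hx [lerk les].
  by split; first exact: leqW.
case: r w2 {w1} => [->|r w2].
  elim: k {w IHk dmono dmono'} => [|k IHk] /=; last by split.
  by move=> m; rewrite msupp0.
apply: coords_impl (IHk _ r _ dmono' w2) => x hx m /hx [lerk les].
have ledr : (d k <= d r)%N by apply: dmono; lia.
split=> //; rewrite big_ord_recr /= addnA addnC -leq_subLR.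
exact: leq_trans (leq_sub2l s ledr) les.
Qed.

Lemma pihomogM s e p q : q \is e.-homog ->
  pihomog mdeg s (p * q) = if (e <= s)%N then pihomog mdeg (s - e) p * q else 0.
Proof.
move=> hq; have lepk := leq_maxl (msize p) s.+1.
rewrite {1}(pihomog_partitionE lepk) mulr_suml raddf_sum /=.
have pE t : pihomog mdeg s (pihomog mdeg t p * q)
    = if (t + e == s)%N then pihomog mdeg t p * q else 0.
  have hpq := dhomogM (pihomogP mdeg t p) hq.
  case: eqP => [<-|/eqP ne]; first exact: pihomog_dE.
  exact: pihomog_ne0 ne hpq.
under eq_bigr do rewrite pE.
case: leqP => [les|lts]; last by rewrite big1 // => t _; case: eqP => //; lia.
have ltsk : (s - e < maxn (msize p) s.+1)%N by lia.
rewrite (bigD1 (Ordinal ltsk)) //= subnK // eqxx big1 ?addr0 // => t.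
rewrite -val_eqE /= => ne; case: eqP => // E; case/eqP: ne; lia.
Qed.

(** Taking components of degree N in an expression of p. *)
Lemma homog_in_span g d k N p :
    (forall i, (i < k)%N -> g i \is (d i).-homog) ->
    p \is N.-homog -> in_span g k p ->
  exists2 c : nat -> R, p = \sum_(i < k) c i * g i &
    forall i, (c i \is (N - d i).-homog) /\ ((N < d i)%N -> c i = 0).
Proof.
move=> hg hp [c defp].
exists (fun i => if (d i <= N)%N then pihomog mdeg (N - d i) (c i) else 0)
  => [|i]; last first.
  by case: leqP => [_|_]; split=> //; [apply: pihomogP | apply: dhomog0].
rewrite -[LHS](pihomog_dE hp) defp raddf_sum /=; apply: eq_bigr => i _.
by rewrite (pihomogM _ _ (hg i _)) //; case: leqP; rewrite ?mul0r.
Qed.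

(** The exponent of x_j^N, with j a natural number so that these powers form a
    sequence of the kind used for regular sequences. *)
Definition xpow N j : 'X_{1..n} :=
  [multinom (if i == j :> nat then N else 0%N) | i < n].

Lemma mdeg_xpow N j : (j < n)%N -> mdeg (xpow N j) = N.
Proof.
move=> ltjn; rewrite mdegE (bigD1 (Ordinal ltjn)) //= mnmE eqxx big1 ?addn0 //.
by move=> i; rewrite -val_eqE /= mnmE => /negPf ->.
Qed.

Lemma in_span_xpow N r p : (r <= n)%N ->
  in_span (fun j => 'X_[xpow N j]) r p <->
  forall m, m \in msupp p -> exists2 i : 'I_n, (i < r)%N & (N <= m i)%N.
Proof.
move=> lern; split=> [[c ->] m|hp].
  case/msupp_sum_le/flatten_mapP => j _; rewrite -/(msupp _).
  rewrite (perm_mem (msuppMX _ _)) => /mapP[m' _ ->].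
  exists (widen_ord lern j); rewrite //= mnmDE mnmE eqxx; lia.
rewrite [p]mpolyE big_seq.
apply: big_ind => [|x y|m /hp [i ltir leN]]; first exact: in_span0.
  exact: in_spanD.
have <- : (m - xpow N i + xpow N i)%MM = m.
  by apply: submK; apply/mnm_lepP => j; rewrite mnmE; case: eqP => // /val_inj ->.
rewrite mpolyXD scalerAl.
by apply: in_spanM; apply: (in_span_mem (fun j => 'X_[xpow N j])).
Qed.

Lemma exponent_pigeonhole N m :
  (n * N < mdeg m + n)%N -> exists i, (N <= m i)%N.
Proof.
move=> ltN; apply/existsP; apply: contraLR ltN; rewrite -leqNgt negb_exists.
move=> /forallP ltmN; rewrite mdegE.
have -> : (\sum_i m i + n = \sum_(i < n) (m i + 1))%N.
  by rewrite big_split /= sum_nat_const card_ord muln1.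
have -> : (n * N = \sum_(i < n) N)%N by rewrite sum_nat_const card_ord.
by apply: leq_sum => i _; rewrite addn1 ltnNge.
Qed.

(** The bound without any genericity assumption: the family x_j^N is regular and
    lies in the span of g, so [colon_rows_wedge] reduces membership of p to a
    count of degrees.  The hypothesis on the sum is conditional because for
    k < n the wedge of n rows is zero and every p, even 1, is in the span. *)
Theorem macaulay_bound g d k N s p :
    (forall i, (i < k)%N -> g i \is (d i).-homog) ->
    (forall i j, (i <= j < k)%N -> (d j <= d i)%N) ->
    (forall q, q \is N.-homog -> in_span g k q) ->
    order_ge s p -> ((n <= k)%N -> (\sum_(i < n) d i < s + n)%N) ->
  in_span g k p.
Proof.
move=> hg dmono hN hp bound.
have /fin_all_exists [c hc] (r : 'I_n) : exists c : nat -> R,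
    ('X_[xpow N r] = \sum_(i < k) c i * g i) /\
    forall i, c i \is (N - d i).-homog.
  have hX : ('X_[xpow N r] : R) \is N.-homog by rewrite dhomogX /= mdeg_xpow.
  have [c defX hc] := homog_in_span hg hX (hN _ hX).
  by exists c; split=> // i; case: (hc i).
(* Row r of A expresses x_r^N by homogeneous coefficients; rows from n on are
   junk. *)
pose A r := oapp c (fun=> 0) (insub r).
have hA r : (r < n)%N -> exists2 i : 'I_n, A r = c i & r = i.
  by move=> ltrn; exists (Ordinal ltrn); rewrite // /A insubT.
apply: (@colon_rows_wedge _ (fun j => 'X_[xpow N j]) g A n).
- move=> r x ltrn; rewrite !in_span_xpow ?(ltnW ltrn) // => hx m mx.
  have /hx [i ltir] : (xpow N r + m)%MM \in msupp ('X_[xpow N r] * x).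
    by rewrite mulrC (perm_mem (msuppMX _ _)) map_f.
  by rewrite mnmDE mnmE ltn_eqF // add0n; exists i.
- by move=> r /hA [i -> ->]; case: (hc i).
have hW r : (r <= n)%N -> ext_order_ge d (s + r * N) r (p *: rows_wedge A k r).
  elim: r => [_|r IHr ltrn] /=.
    rewrite addn0; elim: k {hg dmono hN bound hc A hA} => [|k IHk] /=.
      by rewrite -[p *: 1]/(p * 1) mulr1.
    by rewrite scaler0.
  rewrite -wedgeZ mulSn addnCA addnC; apply: ext_order_ge_wedge (IHr (ltnW ltrn)).
  move=> i _; have [j -> _] := hA r ltrn.
  by case: (hc j) => _ /(_ i); apply: order_ge_homog.
apply: coords_impl (ext_order_ge_coords dmono (hW n (leqnn n))) => x hx.
apply/in_span_xpow => // m /hx [/bound ltd led].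
have [|i lei] := @exponent_pigeonhole N m; first by lia.
by exists i.
Qed.

End Macaulay.

(** * Degree-bounded spaces and their normal forms *)

Section MonomialExtension.
Variables (n : nat) (K : fieldType).
Local Notation R := {mpoly K[n]}.
Implicit Types (p q : R) (m : 'X_{1..n}).
Variable phi : 'X_{1..n} -> R.

Definition monomial_ext p : R := \sum_(m <- msupp p) p@_m *: phi m.

Lemma monomial_ext_over (s : seq 'X_{1..n}) p : uniq s -> {subset msupp p <= s} ->
  monomial_ext p = \sum_(m <- s) p@_m *: phi m.
Proof.
move=> us sps; rewrite (bigID (mem (msupp p))) /= [X in _ + X]big1; last first.
  by move=> m /memN_msupp_eq0 ->; rewrite scale0r.
rewrite addr0 -big_filter; apply: perm_big; apply: uniq_perm.
- exact: msupp_uniq.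
- exact: filter_uniq.
by move=> m; rewrite mem_filter; case: (boolP (m \in msupp p)) => // /sps ->.
Qed.

Lemma monomial_ext_linear c p q :
  monomial_ext (c *: p + q) = c *: monomial_ext p + monomial_ext q.
Proof.
pose s := undup (msupp p ++ msupp q ++ msupp (c *: p + q)).
have sub r : {subset msupp r <= msupp p ++ msupp q ++ msupp (c *: p + q)} ->
    monomial_ext r = \sum_(m <- s) r@_m *: phi m.
  move=> sr; apply: monomial_ext_over; first exact: undup_uniq.
  by move=> m /sr; rewrite mem_undup.
rewrite !sub; try by move=> m mr; rewrite !mem_cat mr ?orbT.
rewrite scaler_sumr -big_split; apply: eq_bigr => m _.
by rewrite mcoeffD mcoeffZ scalerDl scalerA.
Qed.

Lemma monomial_extMX p m :
  monomial_ext (p * 'X_[m]) = \sum_(m' <- msupp p) p@_m' *: phi (m + m').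
Proof.
rewrite /monomial_ext (perm_big _ (msuppMX _ _)) big_map.
by apply: eq_bigr => m' _; rewrite mcoeffMX.
Qed.

End MonomialExtension.

Section LinearSpan.
Variables (n : nat) (K : fieldType).
Local Notation R := {mpoly K[n]}.
Implicit Types (p q f : R) (m : 'X_{1..n}) (F : seq R) (d : nat).

Lemma msize_leP d p :
  (forall m, m \in msupp p -> (mdeg m < d)%N) <-> (msize p <= d)%N.
Proof.
split=> [h|led m /msize_mdeg_lt]; last by move=> h; apply: leq_trans led.
by rewrite msizeE big_seq; apply/bigmax_leqP_seq => m /h.
Qed.

Lemma pdeg_leE d p : (pdeg p <= d)%N = (msize p <= d.+1)%N.
Proof. by rewrite /pdeg; lia. Qed.

Lemma msize_leB d p q :
  (msize p <= d)%N -> (msize q <= d)%N -> (msize (p - q) <= d)%N.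
Proof.
move=> hp hq; apply/msize_leP => m /msuppB_le.
by rewrite mem_cat => /orP[] /msize_mdeg_lt h; apply: leq_trans h _.
Qed.

Lemma msize_leD d p q :
  (msize p <= d)%N -> (msize q <= d)%N -> (msize (p + q) <= d)%N.
Proof.
move=> hp hq; apply/msize_leP => m /msuppD_le.
by rewrite mem_cat => /orP[] /msize_mdeg_lt h; apply: leq_trans h _.
Qed.

Lemma mnm_predecessor m t : mdeg m = t.+1 ->
  exists i m', m = (m' + U_(i))%MM /\ mdeg m' = t.
Proof.
move=> dm; have [i mi] : exists i, (0 < m i)%N.
  apply/existsP; apply: contra_eqT dm; rewrite negb_exists => /forallP m0.
  by rewrite mdegE big1 // => i _; apply/eqP; rewrite -leqn0 leqNgt.
have defm : (m - U_(i) + U_(i))%MM = m by apply: submK; rewrite lep1mP -lt0n.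
exists i, (m - U_(i))%MM; split=> //.
by move: dm; rewrite -{1}defm mdegD mdeg1 addn1 => -[].
Qed.

Lemma msize_XM_le d m p :
  (msize p <= d)%N -> (msize ('X_[m] * p) <= mdeg m + d)%N.
Proof.
move=> hp; apply/msize_leP => m'; rewrite mulrC (perm_mem (msuppMX _ _)).
by case/mapP => m1 /msize_mdeg_lt h1 ->; rewrite mdegD; lia.
Qed.

Lemma Vspace_admissible F d : V_admissible F d (Vspace F d).
Proof.
split=> [|f Ff led V [_ FV _]|m f Vf led V admV]; last 2 first.
- exact: FV.
- by case: (admV) => _ _; apply=> //; apply: Vf.
split=> [V [[V0 _ _] _ _]|p q Vp Vq V admV|c p Vp V admV] //.
- by case: (admV) => [[_ VD _] _ _]; apply: VD; [apply: Vp | apply: Vq].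
- by case: (admV) => [[_ _ VZ] _ _]; apply: VZ; apply: Vp.
Qed.

Lemma Vspace_sum F d (T : eqType) (s : seq T) (P : T -> R) :
  (forall i, i \in s -> Vspace F d (P i)) -> Vspace F d (\sum_(i <- s) P i).
Proof.
have [[V0 VD _] _ _] := Vspace_admissible F d.
by move=> hP; rewrite big_seq; apply: big_ind.
Qed.

Lemma VspaceB F d p q : Vspace F d p -> Vspace F d q -> Vspace F d (p - q).
Proof.
have [[V0 VD VZ] _ _] := Vspace_admissible F d.
by move=> Vp Vq; apply: VD => //; rewrite -scaleN1r; apply: VZ.
Qed.

Lemma VspaceM F d q f :
    (forall m, m \in msupp q -> (mdeg m + msize f <= d.+1)%N) ->
  Vspace F d f -> Vspace F d (q * f).
Proof.
have [[_ _ VZ] _ VM] := Vspace_admissible F d.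
move=> hq Vf; rewrite [q]mpolyE mulr_suml; apply: Vspace_sum => m /hq h.
rewrite -scalerAl; apply: VZ; apply: VM => //.
by rewrite pdeg_leE; apply: leq_trans h; apply: msize_XM_le.
Qed.

Lemma Vspace_sub_ideal F d p : Vspace F d p -> ideal F p.
Proof.
move=> Vp I [I0 ID IM] FI; apply: Vp; split=> [|f Ff _|m f If _].
- by split=> // c q Iq; rewrite -mul_mpolyC; apply: IM.
- exact: FI.
- exact: IM.
Qed.

End LinearSpan.

Section NormalForm.
Variables (n : nat) (K : fieldType).
Local Notation R := {mpoly K[n]}.
Implicit Types (p q f : R) (m : 'X_{1..n}).
Variables (F : seq R) (D : nat).
Hypothesis D_gt0 : (0 < D)%N.
Hypothesis F_le : forall f, f \in F -> (msize f <= D.+1)%N.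
Local Notation V := (Vspace F D.+1).
Hypothesis reduce_top : forall m, mdeg m = D ->
  exists2 q, V ('X_[m] - q) & (msize q <= D)%N.

(** The hypothesis on monomials of degree D, extended linearly. *)
Lemma reduce p : (msize p <= D.+1)%N -> exists2 q, V (p - q) & (msize q <= D)%N.
Proof.
have [[V0 VD VZ] _ _] := Vspace_admissible F D.+1.
move=> lep; rewrite [p]mpolyE big_seq.
apply: (big_ind (fun p => exists2 q, V (p - q) & (msize q <= D)%N))
  => [|p1 p2 [q1 V1 l1] [q2 V2 l2]|m mp].
- by exists 0; rewrite ?subrr ?msize0.
- exists (q1 + q2); first by rewrite opprD addrACA; apply: VD.
  exact: msize_leD.
have [q Vq lq] : exists2 q, V ('X_[m] - q) & (msize q <= D)%N.
  have := leq_trans (msize_mdeg_lt mp) lep; rewrite ltnS leq_eqVlt.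
  case/orP=> [/eqP|ltD]; first exact: reduce_top.
  by exists 'X_[m]; rewrite ?subrr // msizeX.
exists (p@_m *: q); first by rewrite -scalerBr; apply: VZ.
by apply: leq_trans lq; apply: msizeZ_le.
Qed.

Lemma VspaceXi i p : (msize p <= D.+1)%N -> V p -> V ('X_i * p).
Proof.
have [_ _ VM] := Vspace_admissible F D.+1.
move=> lp Vp; apply: VM => //; rewrite pdeg_leE.
by have := msize_XM_le U_(i) lp; rewrite mdeg1.
Qed.

Lemma msize_XiM i d p : (msize p <= d)%N -> (msize ('X_i * p) <= d.+1)%N.
Proof. by move=> lp; have := msize_XM_le U_(i) lp; rewrite mdeg1. Qed.

Lemma Vspace_trans p q r : V (p - q) -> V (q - r) -> V (p - r).
Proof.
have [[_ VD _] _ _] := Vspace_admissible F D.+1.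
by move=> Vpq Vqr; have := VD _ _ Vpq Vqr; rewrite addrA subrK.
Qed.

Lemma Vspace_sym p q : V (p - q) -> V (q - p).
Proof.
have [[V0 _ _] _ _] := Vspace_admissible F D.+1.
by move=> Vpq; rewrite -opprB -sub0r; apply: VspaceB Vpq.
Qed.

(** A monomial of degree t is reduced by dividing out t variables one after the
    other, the order being an arbitrary choice.  Independence of that choice
    modulo V, by induction on t, is the heart of the matter: whether x_i or
    x_j is divided out first, the result is congruent to x_i x_j times the normal
    form of the remaining monomial, a product of degree at most D + 1. *)
Theorem normal_form : exists phi : 'X_{1..n} -> R,
  [/\ forall m, (msize (phi m) <= D)%N,
      forall m i, V (phi (m + U_(i))%MM - 'X_i * phi m)
    & forall m, (mdeg m <= D)%N -> V (phi m - 'X_[m])].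
Proof.
have [[V0 VD VZ] _ _] := Vspace_admissible F D.+1.
have /functional_choice [rho hrho] p : exists q, (msize p <= D.+1)%N ->
    V (p - q) /\ (msize q <= D)%N.
  case: (leqP (msize p) D.+1) => [/reduce [q Vq lq]|_]; first by exists q.
  by exists 0.
pose nf := fix nf (t : nat) m {struct t} : R := if t is t'.+1 then
  if [pick i | (0 < m i)%N] is Some i then rho ('X_i * nf t' (m - U_(i))%MM)
  else 1 else 1.
pose phi m := nf (mdeg m) m.
have small_nf t m : (msize (nf t m) <= D)%N.
  elim: t m => [|t IHt] m /=; first by rewrite msize1.
  case: pickP => [i _|_]; last by rewrite msize1.
  by case: (hrho ('X_i * nf t (m - U_(i))%MM)) => //; apply: msize_XiM.
have rhoV i p : (msize p <= D)%N -> V ('X_i * p - rho ('X_i * p)) /\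
    (msize (rho ('X_i * p)%R) <= D)%N.
  by move=> lp; apply/hrho/msize_XiM.
have mulV i p q : (msize p <= D.+1)%N -> (msize q <= D.+1)%N ->
    V (p - q) -> V ('X_i * p - 'X_i * q).
  by move=> lp lq Vpq; rewrite -mulrBr; apply: VspaceXi => //; apply: msize_leB.
have phiV t m i : mdeg m = t -> V (phi (m + U_(i))%MM - 'X_i * phi m).
  elim/ltn_ind: t m i => t IHt m i dm.
  rewrite /phi mdegD mdeg1 addn1 /=.
  case: pickP => [j|/(_ i)]; last by rewrite mnmDE mnm1E eqxx addn1.
  have [-> _|ne mj] := eqVneq j i.
    by rewrite addmK; apply: Vspace_sym; case: (rhoV i _ (small_nf (mdeg m) m)).
  have mj0 : (0 < m j)%N by move: mj; rewrite mnmDE mnm1E eq_sym (negPf ne) addn0.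
  have defm : (m - U_(j) + U_(j))%MM = m.
    by apply: submK; rewrite lep1mP -lt0n.
  set m' := (m - U_(j))%MM in defm *.
  have dm' : (mdeg m').+1 = mdeg m by rewrite -defm mdegD mdeg1 addn1.
  have -> : (m + U_(i) - U_(j))%MM = (m' + U_(i))%MM.
    by rewrite -defm -addmA (addmC U_(j)%MM) addmA addmK.
  have -> : mdeg m = mdeg (m' + U_(i)) by rewrite mdegD mdeg1 addn1.
  rewrite -/(phi (m' + U_(i))%MM) mdegD mdeg1 addn1 dm' -/(phi m).
  have lt_m' : (mdeg m' < t)%N by rewrite -dm dm'.
  have V1 := IHt _ lt_m' m' i erefl; have V2 := IHt _ lt_m' m' j erefl.
  rewrite defm in V2.
  have sm m1 : (msize (phi m1) <= D)%N by apply: small_nf.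
  apply: Vspace_trans (Vspace_sym (rhoV j _ (sm _)).1) _.
  apply: Vspace_trans (mulV j _ _ (leqW (sm _)) (msize_XiM _ (sm _)) V1) _.
  rewrite mulrCA; apply: Vspace_sym.
  exact: (mulV i _ _ (leqW (sm _)) (msize_XiM _ (sm _)) V2).
exists phi; split=> [m|m i|m]; first exact: small_nf.
  exact: phiV (erefl (mdeg m)).
move: {2}(mdeg m) (erefl (mdeg m)) => t; elim: t m => [|t IHt] m dm leD.
  by move/eqP: dm (dm); rewrite mdeg_eq0 => /eqP -> _; rewrite /phi mdeg0 mpolyX0 subrr.
have [i [m' [defm dm']]] := mnm_predecessor dm.
rewrite {}defm in leD dm *; have lem' : (mdeg m' < D)%N by rewrite dm' -dm.
apply: Vspace_trans (phiV _ m' i erefl) _.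
rewrite mpolyXD [X in _ - X]mulrC; apply: mulV; last exact: IHt (ltnW lem').
  exact/leqW/small_nf.
by rewrite msizeX leqW.
Qed.

(** The polynomials whose normal form is in V are an ideal that contains F, and
    normal forms are congruent to the identity up to degree D. *)
Theorem ideal_sub_Vspace p : ideal F p -> (msize p <= D.+1)%N -> V p.
Proof.
have [[V0 VD VZ] VF _] := Vspace_admissible F D.+1.
have [phi [small phiX phi_low]] := normal_form.
have extV q : (msize q <= D.+1)%N -> V (monomial_ext phi q - q).
  move=> lq; rewrite /monomial_ext [X in _ - X]mpolyE -sumrB.
  apply: Vspace_sum => m mq; rewrite -scalerBr; apply: VZ; apply: phi_low.
  by rewrite -ltnS; apply: leq_trans lq; apply: msize_mdeg_lt.
move=> Ip lep; suff Vext : V (monomial_ext phi p).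
  by have := VspaceB Vext (extV _ lep); rewrite opprB addrCA subrr addr0.
(* It remains to check the ideal property and membership of the generators. *)
apply: (Ip (fun q => V (monomial_ext phi q))); last first.
  move=> f Ff; have Vf : V f by apply: VF; rewrite // pdeg_leE ltnW // ltnS F_le.
  by have := VD _ _ (extV f (F_le Ff)) Vf; rewrite subrK.
have extD q1 q2 : monomial_ext phi (q1 + q2)
    = monomial_ext phi q1 + monomial_ext phi q2.
  by rewrite -{1}[q1]scale1r monomial_ext_linear scale1r.
have ext0 : monomial_ext phi 0 = 0 by rewrite /monomial_ext msupp0 big_nil.
have extZ c q : monomial_ext phi (c *: q) = c *: monomial_ext phi q.
  by rewrite -[c *: q]addr0 monomial_ext_linear ext0 addr0.
split=> [|q1 q2 V1 V2|q1 q Vq]; [by rewrite ext0 | by rewrite extD; apply: VD|].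
have Xi i f : V (monomial_ext phi f) -> V (monomial_ext phi (f * 'X_i)).
  move=> Vf; rewrite monomial_extMX.
  have small_ext : (msize (monomial_ext phi f) <= D)%N.
    rewrite /monomial_ext big_seq.
    apply: (big_ind (fun f => (msize f <= D)%N)) => [|f1 f2 l1 l2|m _].
    - by rewrite msize0.
    - exact: msize_leD.
    by apply: leq_trans (small m); apply: msizeZ_le.
  have Vsum : V (\sum_(m <- msupp f) f@_m *: phi (U_(i) + m)%MM
                 - 'X_i * monomial_ext phi f).
    rewrite mulr_sumr -sumrB; apply: Vspace_sum => m _.
    by rewrite -scalerAr -scalerBr addmC; apply: VZ.
  by have := VD _ _ Vsum (VspaceXi i (leqW small_ext) Vf); rewrite subrK.
have Xm m f : V (monomial_ext phi f) -> V (monomial_ext phi (f * 'X_[m])).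
  move: {2}(mdeg m) (erefl (mdeg m)) => t; elim: t m f => [|t IHt] m f dm Vf.
    by move/eqP: dm; rewrite mdeg_eq0 => /eqP ->; rewrite mpolyX0 mulr1.
  have [i [m' [-> dm']]] := mnm_predecessor dm.
  by rewrite mpolyXD mulrA; apply: Xi; apply: IHt.
rewrite [q1]mpolyE mulr_suml.
apply: (big_ind (fun f => V (monomial_ext phi f))) => [|f1 f2 V1 V2|m _].
- by rewrite ext0.
- by rewrite extD; apply: VD.
by rewrite -scalerAl extZ mulrC; apply: VZ; apply: Xm.
Qed.
End NormalForm.

(** * Groebner bases and the solving degree *)

Section Groebner.
Variables (n : nat) (K : fieldType).
Local Notation R := {mpoly K[n]}.
Implicit Types (p q f : R) (m : 'X_{1..n}).

Lemma lead_msize sigma f m : is_term_order sigma -> degree_compatible sigma ->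
  is_lead_mono sigma f m -> (msize f <= (mdeg m).+1)%N.
Proof.
move=> [_ anti _ _ _] compat [_ maxm]; apply/msize_leP => m' /maxm le_m'm.
rewrite ltnS leqNgt; apply/negP => /compat /andP[le_mm' /eqP]; apply.
by apply: anti; rewrite le_mm' le_m'm.
Qed.

Lemma lead_top sigma q m : is_term_order sigma -> degree_compatible sigma ->
  (msize ('X_[m] - q) <= mdeg m)%N -> is_lead_mono sigma q m.
Proof.
move=> [tot _ _ _ _] compat /msize_leP low.
have qE m' : m' \notin msupp ('X_[m] - q) -> q@_m' = (m == m')%:R.
  move/memN_msupp_eq0; rewrite mcoeffB mcoeffX => /eqP.
  by rewrite subr_eq0 eq_sym => /eqP.
split.
  rewrite mcoeff_msupp qE ?eqxx ?oner_eq0 //.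
  by apply/negP => /low; rewrite ltnn.
move=> m' mq; case: (boolP (m' \in msupp ('X_[m] - q))) => [/low/compat/andP[]//|].
move/qE; case: eqP => [<- _|_ q0]; first by have := tot m m; rewrite orbb.
by move: mq; rewrite mcoeff_msupp q0 eqxx.
Qed.

(** A Groebner basis has to be finite: one polynomial is kept for each of the
    finitely many monomials of s that occur as leading monomials. *)
Lemma lead_selection sigma (P : R -> Prop) (s : seq 'X_{1..n}) :
  exists G : seq R, (forall g, g \in G -> P g) /\
    forall f m, m \in s -> P f -> is_lead_mono sigma f m ->
    exists2 g, g \in G & is_lead_mono sigma g m.
Proof.
elim: s => [|m s [G [PG leadG]]]; first by exists [::].
have [[f Pf lf]|no] := classic (exists2 f, P f & is_lead_mono sigma f m).
  exists (f :: G); split=> [g|f' m']; rewrite inE.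
    by case/orP=> [/eqP -> //|/PG].
  case/orP=> [/eqP -> _ _|ms Pf' lf']; first by exists f; rewrite ?mem_head.
  by have [g Gg lg] := leadG _ _ ms Pf' lf'; exists g; rewrite // inE Gg orbT.
exists G; split=> // f' m'; rewrite inE => /orP[/eqP -> Pf' lf'|]; last exact: leadG.
by case: no; exists f'.
Qed.

(** A leading monomial of degree at most D comes from an element of degree at
    most D, which is in V; one of larger degree is a multiple of a monomial of
    degree D, and those are leading monomials in V. *)
Theorem Vspace_groebner (F : seq R) D sigma :
    is_term_order sigma -> degree_compatible sigma ->
    (forall p, ideal F p -> (msize p <= D.+1)%N -> Vspace F D.+1 p) ->
    (forall m, mdeg m = D ->
       exists2 q, Vspace F D.+1 q & (msize ('X_[m] - q) <= D)%N) ->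
  exists G : seq R, (forall g, g \in G -> Vspace F D.+1 g) /\
    is_groebner_basis sigma G (ideal F).
Proof.
move=> order compat lowV topV.
have [G [VG leadG]] := lead_selection sigma (Vspace F D.+1)
  [seq val b | b : 'X_{1..n < D.+1}].
have {}leadG f m : (mdeg m <= D)%N -> Vspace F D.+1 f -> is_lead_mono sigma f m ->
    exists2 g, g \in G & is_lead_mono sigma g m.
  move=> led; apply: leadG; rewrite -ltnS in led.
  by apply/mapP; exists (BMultinom led); rewrite ?mem_enum.
exists G; split=> //; have GI g : g \in G -> ideal F g.
  by move/VG; apply: Vspace_sub_ideal.
split=> // p; split=> Ip I hI leadI; apply: Ip => // x [f [m [Sf lf ->]]].
  by apply: leadI; exists f, m; split=> //; apply: GI.
case: (leqP (mdeg m) D) => [led|gtD].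
  have Vf : Vspace F D.+1 f.
    by apply: lowV => //; apply: leq_trans (lead_msize order compat lf) _.
  by have [g Gg lg] := leadG f m led Vf lf; apply: leadI; exists g, m.
have [m1 [m2 [-> dm1]]] : exists m1 m2, m = (m2 + m1)%MM /\ mdeg m1 = D.
  move: {2}(mdeg m - D)%N (erefl (mdeg m - D)%N) => t.
  elim: t m gtD {lf} => [|t IHt] m gtD dt; first by lia.
  have [|i [m' [-> dm']]] := @mnm_predecessor n m (D + t); first by lia.
  case: t => [|t] in IHt dt dm' *.
    by exists m', U_(i)%MM; rewrite addmC dm' addn0.
  have [||m1 [m2 [-> dm1]]] := IHt m'; rewrite ?dm'; try lia.
  by exists m1, (m2 + U_(i))%MM; rewrite -!addmA (addmC m1).
have [q Vq lq] := topV m1 dm1; rewrite -dm1 in lq.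
have lead_q := lead_top order compat lq.
have [g Gg lg] := leadG q m1 (eq_leq dm1) Vq lead_q.
case: hI => _ _ IM; rewrite mpolyXD; apply: IM; apply: leadI.
by exists g, m1.
Qed.

End Groebner.

Lemma least_exists (P : nat -> Prop) d : P d ->
  exists s, is_least P s /\ (s <= d)%N.
Proof.
elim/ltn_ind: d => d IHd Pd.
have [[e Pe lted]|least] := classic (exists2 e, P e & (e < d)%N).
  have [s [ls les]] := IHd e lted Pe.
  by exists s; split=> //; apply: leq_trans les (ltnW lted).
exists d; split=> //; split=> // e Pe; rewrite leqNgt; apply/negP => lted.
by case: least; exists e.
Qed.

Section TopParts.
Variables (n : nat) (K : fieldType).
Local Notation R := {mpoly K[n]}.
Implicit Types (p q f : R) (m : 'X_{1..n}).

Lemma ptop_homog f : ptop f \is (pdeg f).-homog.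
Proof. exact: pihomogP. Qed.

Lemma msize_sub_ptop f : (msize (f - ptop f) <= pdeg f)%N.
Proof.
have f_le : (msize f <= (pdeg f).+1)%N by rewrite /pdeg leqSpred.
rewrite {1}(pihomog_partitionE f_le) big_ord_recr /= addrK.
apply: (big_ind (fun p => (msize p <= pdeg f)%N)) => [|p q|i _].
- by rewrite msize0.
- exact: msize_leD.
apply/msize_leP => m mf.
by rewrite (dhomog_mf (pihomogP mdeg i f) mf).
Qed.

Lemma ideal_in_span (G : seq R) p : ideal G p -> in_span (nth 0 G) (size G) p.
Proof.
apply; last by move=> f /(nthP 0) [i ltiG <-]; apply: in_span_mem.
split; [exact: in_span0 | exact: in_spanD | exact: in_spanM].
Qed.

(** Replacing each top part by the polynomial it comes from, in a homogeneous
    expression of a monomial, changes only terms of lower degree. *)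
Lemma top_lift (F : seq R) D m :
    (forall f, f \in F -> (pdeg f <= D)%N) -> mdeg m = D ->
    in_span (fun i => ptop (nth 0 F i)) (size F) 'X_[m] ->
  exists2 q, Vspace F D.+1 q & (msize ('X_[m] - q) <= D)%N.
Proof.
move=> F_le dm Im; pose d i := pdeg (nth 0 F i).
have hX : ('X_[m] : R) \is D.-homog by rewrite dhomogX /= dm.
have [i _|c defX hc] := homog_in_span (d := d) _ hX Im; first exact: ptop_homog.
have c_le (i : 'I_(size F)) m' : m' \in msupp (c i) -> (mdeg m' + d i = D)%N.
  case: (hc i) => hci _ /(dhomog_mf hci) ->; rewrite subnK //.
  by apply/F_le/mem_nth.
exists (\sum_(i < size F) c i * nth 0 F i).
  apply: Vspace_sum => i _; apply: VspaceM => [m' /c_le <-|].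
    by rewrite -!addnS leq_add2l /d /pdeg; lia.
  have [_ VF _] := Vspace_admissible F D.+1; apply: VF; first exact: mem_nth.
  by apply/leqW/F_le/mem_nth.
rewrite defX -sumrB; apply: (big_ind (fun p => (msize p <= D)%N)) => [|p q|i _].
- by rewrite msize0.
- exact: msize_leD.
rewrite -mulrBr; apply/msize_leP => m'.
case/msuppM_le/allpairsP => [[m1 m2] /= [/c_le <- h2 ->]].
have := msize_mdeg_lt h2; rewrite -opprB mmeasureN => lt2.
by rewrite mdegD ltn_add2l; apply: leq_trans lt2 (msize_sub_ptop _).
Qed.

End TopParts.

Theorem corollary3p12 (K : fieldType) (n k : nat) (F : k.-tuple {mpoly K[n]})
    (Fdeg : forall i : 'I_k, (1 <= pdeg (tnth F i))%N)
    (Fsorted : forall i j : 'I_k, (i <= j)%N ->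
       (pdeg (tnth F j) <= pdeg (tnth F i))%N)
    (Freg : exists d : nat, is_degree_of_regularity F d) :
  (n <= k)%N /\
  forall sigma : rel 'X_{1..n},
    is_term_order sigma -> degree_compatible sigma ->
    exists s : nat, is_solving_degree sigma F s /\
      (s <= \sum_(i < k | (i < n)%N) pdeg (tnth F i) - n + 2)%N.
Proof.
have [N [regN _]] := Freg.
pose g i := ptop (nth 0 F i); pose d i := pdeg (nth 0 F i).
have dE (i : 'I_k) : pdeg (tnth F i) = d i by rewrite (tnth_nth 0).
have g_homog i : (i < k)%N -> g i \is (d i).-homog by move=> _; apply: ptop_homog.
have d_gt0 i : (i < k)%N -> (0 < d i)%N
  by move=> ltik; have := Fdeg (Ordinal ltik); rewrite dE.
have d_mono i j : (i <= j < k)%N -> (d j <= d i)%N.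
  move=> /andP[leij ltjk]; have ltik := leq_ltn_trans leij ltjk.
  by have := Fsorted (Ordinal ltik) (Ordinal ltjk) leij; rewrite !dE.
have spanN q : q \is N.-homog -> in_span g k q.
  move=> hq; have [_ /(_ (conj I hq)) [/ideal_in_span [c ->] _]] := regN q.
  exists c; rewrite size_map size_tuple; apply: eq_bigr => i _.
  by rewrite (nth_map 0) ?size_tuple.
have bound s p : order_ge s p -> ((n <= k)%N -> (\sum_(i < n) d i < s + n)%N) ->
    in_span g k p.
  exact: macaulay_bound g_homog d_mono spanN.
have le_nk : (n <= k)%N.
  rewrite leqNgt; apply/negP => lt_kn.
  (* Having positive degree, the g i cannot generate 1. *)
  have I1 : in_span g k 1 by apply: (bound 0%N) => //; rewrite leqNgt lt_kn.
  have [c def1 hc] := homog_in_span g_homog (dhomog1 _ _) I1.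
  move/eqP: def1; rewrite big1 ?oner_eq0 // => i _.
  by have [_ ->] := hc i; rewrite ?mul0r ?d_gt0.
split=> // sigma order compat.
rewrite (eq_bigr (fun i : 'I_k => d i)) // -(big_ord_widen k d le_nk).
set D := (\sum_(i < n) d i - n).+1.
have le_n_sum : (n <= \sum_(i < n) d i)%N.
  rewrite -{1}[n]card_ord -sum1_card; apply: leq_sum => i _.
  by apply/d_gt0/(leq_trans (ltn_ord i)).
have F_le f : f \in F -> (pdeg f <= D)%N.
  case/(nthP 0) => i; rewrite size_tuple => ltik <-; rewrite -/(d i).
  (* A polynomial of positive degree needs a variable; then D is at least the
     largest degree d 0, the others contributing d i - 1 >= 0 each. *)
  have n_gt0 : (0 < n)%N.
    rewrite lt0n; apply/eqP => n0; have := d_gt0 i ltik.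
    suff : (msize (nth 0%R F i) <= 1)%N by rewrite /d /pdeg; lia.
    apply/msize_leP => m _; rewrite ltnS leqn0 mdegE big1 // => j.
    by have := leq_trans (ltn_ord j) (eq_leq n0).
  have di_le : (d i <= d 0)%N by apply: d_mono; rewrite ltik.
  have : (n.-1 + d 0 <= \sum_(i < n) d i)%N.
    rewrite (bigD1 (Ordinal n_gt0)) //= addnC leq_add2l.
    have <- : #|[pred j : 'I_n | j != Ordinal n_gt0]| = n.-1.
      by rewrite cardC1 card_ord.
    rewrite -sum1_card; apply: leq_sum => j _.
    by apply/d_gt0/(leq_trans (ltn_ord j)).
  by rewrite /D; lia.
have topV m : mdeg m = D -> exists2 q, Vspace F D.+1 q & (msize ('X_[m] - q) <= D)%N.
  move=> dm; apply: (top_lift F_le dm); rewrite size_tuple.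
  apply: (bound D) => [m'|_]; first by rewrite msuppX inE => /eqP ->; rewrite dm.
  by rewrite /D; lia.
rewrite addnS addn1 -/D; apply: least_exists.
apply: (Vspace_groebner order compat) => // p Ip lep.
apply: (ideal_sub_Vspace _ _ _ Ip lep) => // [f /F_le|m /topV [q Vq lq]].
  by rewrite pdeg_leE.
exists ('X_[m] - q) => //; by rewrite opprB addrCA subrr addr0.
Qed.
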